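(* Let $B=\{(j,s): 0\le j\le m-1,\ s\in\{+,-\},\ r_{j,s}>0\}$. If the one-dimensional signed row-branch iterated function system $\{g_{j,s}:(j,s)\in B\}$ satisfies the open set condition, then $$\dim_{\mathrm H} K=\frac{1}{\log m}\log\left(\sum_{(j,s)\in B}r_{j,s}^{\beta}\right).$$
   Context: Let $2\le m<n$ be integers, let $D\subset\{0,\ldots,n-1\}\times\{0,\ldots,m-1\}$ be a non-empty digit set, and put $\beta=\log m/\log n$. For each digit $d=(i,j)\in D$ choose signs $\sigma_d,\eta_d\in\{-1,1\}$ and define $$S_d(x,y)=\left(\frac{\sigma_d x+a_d}{n},\frac{\eta_d y+b_d}{m}\right),$$ where $a_d=i$ if $\sigma_d=1$ and $a_d=i+1$ if $\sigma_d=-1$; and $b_d=j$ if $\eta_d=1$ and $b_d=j+1$ if $\eta_d=-1$. The reflected carpet $K$ is the attractor of $\{S_d:d\in D\}$, i.e. the unique non-empty compact set $K\subset\mathbb R^2$ with $K=\bigcup_{d\in D}S_d(K)$. Put $D_{j,+}=\{i:(i,j)\in D,\ \eta_{(i,j)}=1\}$, $D_{j,-}=\{i:(i,j)\in D,\ \eta_{(i,j)}=-1\}$, $r_{j,+}=\#D_{j,+}$, $r_{j,-}=\#D_{j,-}$. The signed row branches are the maps of $\mathbb R$ $$g_{j,+}(y)=\frac{y+j}{m},\qquad g_{j,-}(y)=\frac{j+1-y}{m}.$$ A finite family $\{g_a:a\in A\}$ of contracting similarities of $\mathbb R$ satisfies the open set condition if there is a non-empty bounded open set $U\subset\mathbb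 R$ with $g_a(U)\subset U$ for all $a\in A$ and $g_a(U)\cap g_{a'}(U)=\varnothing$ for all $a\ne a'$ in $A$. $\dim_{\mathrm H}$ denotes Hausdorff dimension. *)

(* Defs.v *)
From HB Require Import structures.
From mathcomp Require Import all_boot all_order all_algebra.
From mathcomp Require Import all_classical all_reals all_analysis.

Set Implicit Arguments.
Unset Strict Implicit.
Unset Printing Implicit Defensive.

Import Order.TTheory GRing.Theory Num.Theory.
Import numFieldNormedType.Exports.

Local Open Scope classical_set_scope.
Local Open Scope ring_scope.

Section Hausdorff.
Context {R : realType}.
Implicit Types (p q : R * R) (A E : set (R * R)) (s delta : R).

(* The library norm on [R * R] is the max norm, so the Euclidean metric is
   written out; both induce the product topology carried by [R * R]. *)
Definition edist p q : R :=
  Num.sqrt ((p.1 - q.1) ^+ 2 + (p.2 - q.2) ^+ 2).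

(* With this definition [diam set0 = -oo]. *)
Definition diam A : \bar R :=
  ereal_sup [set (edist p q)%:E | p in A & q in A].

(* |A|^s, with |set0|^s = 0 for every s and |{p}|^0 = 1, so that the
   0-dimensional Hausdorff measure is the counting measure. *)
Definition diam_pow s A : \bar R :=
  if A == set0 then 0%E else poweR (diam A) s.

(* Finite covers are included, since a cover may be padded with [set0]. *)
Definition delta_cover delta E (U : nat -> set (R * R)) : Prop :=
  (forall k, (diam (U k) <= delta%:E)%E) /\ E `<=` \bigcup_k U k.

Definition hausdorff_premeasure s delta E : \bar R :=
  ereal_inf [set (\sum_(0 <= k <oo) diam_pow s (U k))%E
            | U in delta_cover delta E].

(* The premeasure is nonincreasing in delta: the limit as delta tends to 0 is
   the supremum over delta > 0. *)
Definition hausdorff_measure s E : \bar R :=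
  ereal_sup [set hausdorff_premeasure s delta E
            | delta in [set delta : R | 0 < delta]].

Definition hausdorff_dim E : \bar R :=
  ereal_inf [set s%:E
            | s in [set s : R | 0 <= s /\ hausdorff_measure s E = 0%E]].

End Hausdorff.

Definition is_attractor (T : topologicalType) (I : finType) (D : {set I})
    (S : I -> T -> T) (K : set T) : Prop :=
  [/\ K !=set0, compact K & K = \bigcup_(d in [set` D]) (S d @` K)].

Definition open_set_condition (R : realType) (I : finType) (A : {set I})
    (g : I -> R -> R) : Prop :=
  exists U : set R,
    [/\ U !=set0, bounded_set U, open U,
        forall a, a \in A -> g a @` U `<=` U &
        forall a a', a \in A -> a' \in A -> a != a' ->
          (g a @` U) `&` (g a' @` U) = set0].

(* Signs are booleans: [true] is + (the value 1), [false] is - (the value -1).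
   Sign functions are total on the grid, but only their values on the digit
   set are ever used. *)
Definition sign_val (R : realType) (s : bool) : R := if s then 1 else -1.

Section Carpet.
Context {R : realType} {n m : nat}.
Implicit Types (D : {set 'I_n * 'I_m}) (sigma eta : 'I_n * 'I_m -> bool).

Definition sign_shift (s : bool) (k : nat) : R :=
  if s then k%:R else k.+1%:R.

Definition carpet_map sigma eta (d : 'I_n * 'I_m) (p : R * R) : R * R :=
  ((sign_val R (sigma d) * p.1 + sign_shift (sigma d) d.1) / n%:R,
   (sign_val R (eta d) * p.2 + sign_shift (eta d) d.2) / m%:R).

Definition row_branch (b : 'I_m * bool) (y : R) : R :=
  if b.2 then (y + b.1%:R) / m%:R else (b.1.+1%:R - y) / m%:R.

End Carpet.

Section Rows.
Context {n m : nat}.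
Implicit Types (D : {set 'I_n * 'I_m}) (eta : 'I_n * 'I_m -> bool).

Definition row_digits D eta (b : 'I_m * bool) : {set 'I_n} :=
  [set i | ((i, b.1) \in D) && (eta (i, b.1) == b.2)]%SET.

Definition row_count D eta (b : 'I_m * bool) : nat := #|row_digits D eta b|.

Definition row_branches D eta : {set 'I_m * bool} :=
  [set b | (0 < row_count D eta b)%N]%SET.

End Rows.

(* Main.v *)
Require Import Defs.
From HB Require Import structures.
From mathcomp Require Import all_boot all_order all_algebra.
From mathcomp Require Import all_classical all_reals all_analysis.
From mathcomp Require Import ring lra.
Import Order.TTheory GRing.Theory Num.Theory.
Import numFieldNormedType.Exports.
Local Open Scope classical_set_scope.
Local Open Scope ring_scope.

(* Set Z = sum_b r_b^beta, delta = log_m Z, and call an approximate square of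
   level (l, k) the set of points of K with a given word of l digits and a given
   continuation by k - l row branches; when n^l is about m^k it has diameter
   about m^-k.

   Upper bound: the weights r_b^(beta - 1) on digits and r_b^beta on rows give
   total mass Z^k to the squares of level (l, k), and the mass of one square is
   exp(beta S_k - S_l), where S is the sum of the log r_b along the row coding.
   Following the chain of levels l, k(l), k(k(l)), ... for boundedly many steps,
   every coding meets a level with beta S_k - S_l >= - e l - O(1), since
   otherwise the averages S_k / k would become negative.  So finitely many levels
   suffice to cover K by squares of mass at least exp(- e l - O(1)).

   Lower bound: among the row words of length q, sort by letter counts and keep
   the type carrying most of Z^q.  This gives T row words, all having the same
   number r of digit words above them, with T r^beta >= Z^q / (q + 1)^(2m).  For
   this homogeneous subsystem, uniform counting of words plus the open set
   condition bounds the fraction of words whose point lies in a ball of radius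
   rho by C rho^s with s = log T / (q log m) + log r / (q log n), which tends to
   delta as q grows. *)

Set Implicit Arguments.
Unset Strict Implicit.
Unset Printing Implicit Defensive.

(** * Words of affine maps and separated points *)

Lemma all2_map_eq (A : Type) (B : eqType) (row : A -> B) w w' :
  map row w = map row w' -> all2 (fun x y => row x == row y) w w'.
Proof. by elim: w w' => [|x w IH] [|y w'] //= [-> /IH ->]; rewrite eqxx. Qed.

Section Affine.
Context {R : realType}.
Implicit Types (f g : R -> R) (lam : R) (U : set R).

(** Only the absolute value of the slope is fixed, so that reflected and unreflected branches are
    treated alike and a word of such maps has ratio [lam ^+ size w]. *)
Definition affine lam f := exists2 e, `|e| = lam & exists c, forall x, f x = e * x + c.

Lemma affine_dist lam f x y : affine lam f -> `|f x - f y| = lam * `|x - y|.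
Proof.
by move=> [e <- [c fE]]; rewrite !fE opprD addrACA subrr addr0 -mulrBr normrM.
Qed.

Lemma affine_inj lam f : 0 < lam -> affine lam f -> injective f.
Proof.
move=> lam_gt0 faff x y fxy; apply/eqP; rewrite -subr_eq0 -normr_eq0.
have := affine_dist x y faff; rewrite fxy subrr normr0 => /esym/eqP.
by rewrite mulf_eq0 gt_eqF.
Qed.

Lemma affine_surj lam f y : 0 < lam -> affine lam f -> exists x, f x = y.
Proof.
move=> lam_gt0 [e elam [c fE]]; exists ((y - c) / e).
have e0 : e != 0 by rewrite -normr_eq0 elam gt_eqF.
by rewrite fE mulrC divfK// subrK.
Qed.

Lemma affine_foldr (A : Type) (f : A -> R -> R) lam w :
  (forall a, affine lam (f a)) -> affine (lam ^+ size w) (fun x => foldr f x w).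
Proof.
move=> faff; elim: w => [|a w [e elam [c IH]]] /=.
  by exists 1; [rewrite normr1|exists 0 => x; rewrite mul1r addr0].
have [e' e'lam [c' fE]] := faff a.
exists (e' * e); first by rewrite normrM e'lam elam exprS.
by exists (e' * c + c') => x; rewrite fE IH mulrDr !mulrA addrA.
Qed.

(** If [g u] were closer to [f u], it would equal [f x] for some [x] within [rho] of [u], and the
    images of [U] would meet. *)
Lemma affine_separated lam f g U u rho : 0 < lam -> affine lam f ->
  affine lam g -> ball u rho `<=` U ->
  (forall x y, U x -> U y -> f x <> g y) -> 0 < rho ->
  lam * rho <= `|f u - g u|.
Proof.
move=> lam_gt0 faff gaff ballU disj rho_gt0; rewrite leNgt; apply/negP => lt.
have [x fx] := affine_surj (g u) lam_gt0 faff.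
apply: (disj x u) => //; apply: ballU; last exact: ballxx.
rewrite /ball /= -(ltr_pM2l lam_gt0).
by rewrite -(affine_dist u x faff) fx.
Qed.

Lemma foldr_stable (A T : Type) (f : A -> T -> T) (U : set T) (W : pred A) w x :
  (forall a x, W a -> U x -> U (f a x)) -> all W w -> U x -> U (foldr f x w).
Proof. by move=> fU; elim: w => //= a w IH /andP[Wa Ww] Ux; apply: fU => //; apply: IH. Qed.

(** A common prefix is cancelled by injectivity, and the first differing letters send the tails,
    which stay in [U], to different points. The relation [e] allows disjointness to be asked only of
    letters in a common row. *)
Lemma foldr_disjoint (A : eqType) (f : A -> R -> R) lam U (W : pred A) (e : rel A) w w' :
  0 < lam -> (forall a, affine lam (f a)) ->
  (forall a x, W a -> U x -> U (f a x)) ->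
  (forall a b x y, W a -> W b -> e a b -> a != b -> U x -> U y -> f a x <> f b y) ->
  all W w -> all W w' -> all2 e w w' -> w != w' ->
  forall x y, U x -> U y -> foldr f x w <> foldr f y w'.
Proof.
move=> lam_gt0 faff fU disj; elim: w w' => [|a w IH] [|b w'] //=.
move=> /andP[Wa Ww] /andP[Wb Ww'] /andP[eab ew] + x y Ux Uy.
rewrite eqseq_cons negb_and; have [-> /= ww'|ab _] := eqVneq a b.
  by move/(affine_inj lam_gt0 (faff b)); exact: IH.
apply: disj => //; exact: foldr_stable fU _ _.
Qed.

(* Points separated by [a] fall into distinct cells of a grid of mesh [a]. *)
Lemma card_separated (I : finType) (P : {set I}) (c : I -> R) (p a L : R) (C : nat) :
  0 < a -> 2 * L < C%:R * a ->
  (forall i, i \in P -> `|c i - p| <= L) ->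
  (forall i j, i \in P -> j \in P -> i != j -> a <= `|c i - c j|) ->
  (#|P| <= C)%N.
Proof.
move=> a_gt0 LC cL sep.
(* For [C = 0] the hypothesis forces [L < 0], so [P] is empty; otherwise there is at least one cell
   to number. *)
case: C LC => [|C] LC.
  rewrite leqn0; apply/eqP/eqP; rewrite cards_eq0; apply/eqP/setP => i; rewrite inE.
  apply/negP => /cL; rewrite leNgt => /negP; apply.
  by rewrite (@lt_le_trans _ _ 0)//; lra.
pose t i := (c i - p + L) / a.
pose cell i : 'I_C.+1 := inord (Num.truncn (t i)).
have t_ge0 i : i \in P -> 0 <= t i.
  by move=> /cL; rewrite ler_norml => /andP[h _]; apply: divr_ge0; [lra|exact: ltW].
have tC i : i \in P -> (Num.truncn (t i) < C.+1)%N.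
  move=> iP; rewrite -(ltr_nat R) (@le_lt_trans _ _ (t i))//.
    by rewrite truncn_le ?t_ge0.
  rewrite ltr_pdivrMr//; move: (cL _ iP); rewrite ler_norml => /andP[_ h].
  by apply: le_lt_trans LC; lra.
have cell_inj : {in P &, injective cell}.
  move=> i j iP jP /(congr1 (@nat_of_ord C.+1)); rewrite /cell !inordK ?tC// => tij.
  apply: contraTeq isT => ij; have := sep _ _ iP jP ij.
  have /andP[i1 i2] := truncn_itv (t_ge0 _ iP).
  have /andP[j1 j2] := truncn_itv (t_ge0 _ jP).
  rewrite tij in i1 i2; move: i1 i2 j1 j2.
  rewrite -natr1 /t !(ler_pdivlMr,ltr_pdivrMr)// (mulrDl _ 1) mul1r.
  set x := _ * a => i1 i2 j1 j2.
  by rewrite leNgt => /negP[]; rewrite ltr_norml; apply/andP; split; lra.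
by rewrite -(card_in_imset cell_inj) (leq_trans (max_card _))// card_ord.
Qed.

End Affine.

(** * Hausdorff premeasures and the mass distribution principle *)

Local Notation edist := Defs.edist.

Section Hausdorff.
Context {R : realType}.
Implicit Types (A E U : set (R * R)) (s t delta : R).

Lemma edist_ge_norm (p q : R * R) : `|p - q| <= edist p q.
Proof.
have h (a b : R) : `|a| <= Num.sqrt (a ^+ 2 + b ^+ 2).
  by rewrite -sqrtr_sqr ler_sqrt ?addr_ge0 ?sqr_ge0// lerDl sqr_ge0.
by rewrite prod_normE /= ge_max /Defs.edist h/= [X in Num.sqrt X]addrC h.
Qed.

Lemma edist_le_sum (p q : R * R) : edist p q <= `|p.1 - q.1| + `|p.2 - q.2|.
Proof.
have h : 0 <= `|p.1 - q.1| + `|p.2 - q.2| by rewrite addr_ge0.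
rewrite -[leRHS]ger0_norm// -[leRHS]sqrtr_sqr /Defs.edist ler_sqrt ?sqr_ge0//.
rewrite [leRHS]sqrrD !real_normK ?num_real// addrAC lerDl.
by rewrite mulrn_wge0// mulr_ge0.
Qed.

Lemma edist_ge0 (p q : R * R) : 0 <= edist p q.
Proof. exact: sqrtr_ge0. Qed.

Lemma edist_le_diam A p q : A p -> A q -> ((edist p q)%:E <= diam A)%E.
Proof. by move=> Ap Aq; apply: ereal_sup_ubound; exists p => //; exists q. Qed.

Lemma diam_ge0 A : A !=set0 -> (0 <= diam A)%E.
Proof.
by move=> [p Ap]; apply: le_trans (edist_le_diam Ap Ap); rewrite lee_fin edist_ge0.
Qed.

Lemma diam_le A c : (forall p q, A p -> A q -> edist p q <= c) -> (diam A <= c%:E)%E.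
Proof. by move=> Ac; apply: ge_ereal_sup => _ [p Ap [q Aq <-]]; rewrite lee_fin Ac. Qed.

Lemma diam_pow_ge0 s A : (0 <= diam_pow s A)%E.
Proof. by rewrite /diam_pow; case: ifP => // _; exact: poweR_ge0. Qed.

Lemma diam_pow_le s A c : 0 <= s -> 0 <= c -> (diam A <= c%:E)%E ->
  (diam_pow s A <= (c `^ s)%:E)%E.
Proof.
move=> s0 c0 Ac; rewrite /diam_pow; case: ifPn => [_|/set0P A0].
  by rewrite lee_fin powR_ge0.
rewrite -poweR_EFin gt0_ler_poweR// in_itv/= ?leey ?andbT ?lee_fin//.
exact: diam_ge0.
Qed.

Lemma hausdorff_premeasure_ge0 s delta E : (0 <= hausdorff_premeasure s delta E)%E.
Proof.
apply: le_ereal_inf_tmp => _ [U _ <-]; apply: nneseries_ge0 => k _ _; exact: diam_pow_ge0.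
Qed.

(** The family is listed along [enum I] and padded with [set0], which adds nothing even for [s = 0]
    by the convention in [diam_pow]. *)
Lemma hausdorff_premeasure_le_finite s delta E (I : finType) (V : I -> set (R * R)) :
  E `<=` \bigcup_i V i -> (forall i, (diam (V i) <= delta%:E)%E) ->
  (hausdorff_premeasure s delta E <= \sum_i diam_pow s (V i))%E.
Proof.
move=> EV Vdelta; pose U k := nth set0 [seq V i | i <- enum I] k.
have nthU (i : 'I_#|I|) : U i = V (enum_val i).
  by rewrite /U (nth_map (enum_val i)) -?cardE ?ltn_ord// -enum_val_nth.
have U0 k : (#|I| <= k)%N -> U k = set0.
  by move=> Ik; rewrite /U nth_default// size_map -cardE.
apply: ereal_inf_lbound; exists U.
  split=> [k|p /EV[i _ Vp]].
    have [kI|Ik] := ltnP k #|I|; first by rewrite (nthU (Ordinal kI)).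
    by rewrite U0// /diam; apply: ge_ereal_sup => ? [?].
  by exists (enum_rank i) => //; rewrite nthU enum_rankK.
rewrite (nneseries_split 0 #|I|); last by move=> *; exact: diam_pow_ge0.
rewrite [X in (_ + X)%E]eseries0 ?adde0 ?add0n; last first.
  by move=> k Ik _; rewrite U0// /diam_pow eqxx.
rewrite big_mkord (big_enum_val (fun i => diam_pow s (V i))).
by apply: eq_bigr => i _; rewrite nthU.
Qed.

Lemma compact_cover_plane (K : set (R * R)) : compact K -> cover_compact K.
Proof.
have h := @compact_cover ((R^o * R^o)%type : normedModType R).
by move=> cK; move: (cK : @compact (R^o * R^o)%type K); rewrite h.
Qed.

(* Enlarging each covering set to an open ball makes compactness available, and
   a ball of radius [r] captures at most the fraction [C * r `^ t] of the points. *)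
Lemma mass_distribution (K : set (R * R)) (t C delta : R) (I : nat -> finType)
    (x : forall N, I N -> R * R) :
  compact K -> 0 <= t -> 0 < C ->
  (forall N i, K (x N i)) -> (forall N, 0 < #|I N|)%N ->
  (forall p r, 0 < r -> exists N0, forall N, (N0 <= N)%N ->
     #|[set i | `[< ball p r (x N i) >]]%SET|%:R <= C * #|I N|%:R * r `^ t) ->
  (C^-1%:E <= hausdorff_premeasure t delta K)%E.
Proof.
move=> cK t0 C0 xK I0 count.
apply: le_ereal_inf_tmp => _ [U [Udelta KU] <-].
apply/lee_addgt0Pr => e e0.
(* The slack has total at most [e], makes [v k] positive, and leaves room to replace [U k] by a
   slightly larger open ball. *)
pose v k := fine (diam_pow t (U k)) + e / (2 ^ k.+1)%:R.
have e2 k : 0 < e / (2 ^ k.+1)%:R by rewrite divr_gt0// ltr0n expn_gt0.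
have diam_fin k : U k !=set0 -> diam (U k) \is a fin_num.
  move=> U0; rewrite ge0_fin_numE ?diam_ge0//.
  exact: le_lt_trans (Udelta k) (ltry _).
have v_fin k : diam_pow t (U k) \is a fin_num.
  rewrite /diam_pow; case: ifPn => // /set0P U0.
  by rewrite fin_num_poweR// diam_fin.
have v0 k : 0 < v k by rewrite ltr_wpDl// fine_ge0// diam_pow_ge0.
have /choice[G Gprop] : forall k, exists GN : set (R * R) * nat,
    [/\ open GN.1, U k `<=` GN.1 & forall N, (GN.2 <= N)%N ->
       #|[set i | `[< GN.1 (x N i) >]]%SET|%:R <= C * #|I N|%:R * v k].
  move=> k; have [U0|/set0P/[dup] U0 [p Up]] := eqVneq (U k) set0.
    exists (set0, 0%N); rewrite U0; split => //=.
    move=> N _; rewrite (_ : [set _ | _]%SET = finset.set0) ?cards0.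
      by rewrite mulr_ge0 ?ltW// mulr_gt0// ltr0n.
    by apply/setP => i; rewrite !inE; apply/asboolP.
  pose d := fine (diam (U k)).
  have dE : diam (U k) = d%:E by rewrite fineK// diam_fin.
  have d0 : 0 <= d by rewrite fine_ge0// diam_ge0.
  have vE : v k = d `^ t + e / (2 ^ k.+1)%:R.
    by rewrite /v /diam_pow ifN ?dE//; apply/set0P.
  (* For [t = 0] any radius above [d] will do, both powers being 1; for [t > 0] the radius solves
     [r ^ t = v k]. *)
  have [r dr rv] : exists2 r, d < r & r `^ t <= v k.
    move: t0; rewrite le_eqVlt => /predU1P[t0|t0].
      by exists (d + 1); rewrite ?ltrDl// vE -t0 !powRr0 lerDl ltW.
    exists (v k `^ t^-1); last by rewrite -powRrM mulVf ?gt_eqF// powRr1// ltW.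
    rewrite -[ltLHS](@powRr1 _ d)// -[in ltLHS](mulfV (lt0r_neq0 t0)) powRrM.
    apply: gt0_ltr_powR; rewrite ?invr_gt0// ?nnegrE ?powR_ge0 ?ltW//.
    by rewrite vE ltrDl.
  have r0 : 0 < r by exact: le_lt_trans dr.
  have [N0 hN] := count p r r0.
  exists (ball p r, N0); split => /=; first exact: ball_open.
    move=> q Uq; rewrite -ball_normE /=; apply: le_lt_trans dr.
    apply: (le_trans (edist_ge_norm _ _)).
    by rewrite -lee_fin -dE edist_le_diam.
  move=> N /hN /le_trans; apply; rewrite ler_wpM2l// mulr_ge0// ltW//.
move: cK => /compact_cover_plane /(_ nat setT (fun k => (G k).1)).
case=> [k _|p /KU[k _ Up]|X _ KX]; first by have [] := Gprop k.
  by exists k => //; have [_ + _] := Gprop k; apply.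
(* All indices of the finite subcover lie below [M], and [N] reaches all their thresholds, so the
   same points can be counted in every open set. *)
pose M := (\max_(k <- finmap.enum_fset X) k).+1.
pose N := (\max_(k < M) (G k).2)%N.
have cardI : (#|I N| <= \sum_(k < M) #|[set i | `[< (G k).1 (x N i) >]]%SET|)%N.
  under eq_bigr do rewrite -sum1_card big_mkcond /=.
  rewrite exchange_big -sum1_card /=; apply: leq_sum => i _.
  have [k /= kX Gk] := KX _ (xK N i).
  have kM : (k < M)%N by rewrite ltnS; exact: leq_bigmax_seq.
  rewrite (bigD1 (Ordinal kM))//= inE; case: asboolP => //.
have : #|I N|%:R <= C * #|I N|%:R * \sum_(k < M) v k.
  apply: (@le_trans _ _ (\sum_(k < M) #|[set i | `[< (G k).1 (x N i) >]]%SET|%:R)).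
    by rewrite -natr_sum ler_nat.
  rewrite mulr_sumr; apply: ler_sum => k _; have [_ _ ->//] := Gprop k.
  by rewrite /N; exact: leq_bigmax.
rewrite mulrAC -[leLHS]mul1r ler_pM2r ?ltr0n// -ler_pdivrMl// mulr1 => CM.
apply: (@le_trans _ _ (\sum_(0 <= k <oo) (v k)%:E)%E).
  apply: (@le_trans _ _ (\sum_(0 <= k < M) (v k)%:E)%E).
    by rewrite sumEFin lee_fin big_mkord.
  by apply: nneseries_lim_ge => k _ _; rewrite lee_fin ltW.
apply: le_trans (epsilon_trick xpredT (fun k => diam_pow_ge0 t (U k)) (ltW e0)).
apply: lee_nneseries => [k _|k _]; first by rewrite lee_fin ltW.
by rewrite /v EFinD fineK.
Qed.

End Hausdorff.

(** * Counting words whose point lies in a ball *)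

Section Counting.

Lemma card_le_fibres (I J : finType) (X : {set I}) (g : I -> J) (c1 c2 : nat) :
  (#|g @: X| <= c1)%N ->
  (forall j, j \in g @: X -> (#|[set i in X | g i == j]%SET| <= c2)%N) ->
  (#|X| <= c1 * c2)%N.
Proof.
move=> Xc1 gc2; rewrite -sum1_card (partition_big_imset g)/=.
apply: (@leq_trans (\sum_(j in g @: X) c2)%N).
  apply: leq_sum => j /gc2; rewrite -sum1_card; apply: leq_trans.
  by apply: eq_leq; apply: eq_bigl => i; rewrite inE.
by rewrite sum_nat_const leq_mul2r Xc1 orbT.
Qed.

Lemma card_tuple_family N (A : finType) (F : 'I_N -> {set A}) :
  #|[set t : N.-tuple A | [forall i, tnth t i \in F i]]%SET| = (\prod_i #|F i|)%N.
Proof.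
have tab_inj : injective (fun f : {ffun 'I_N -> A} => [tuple f i | i < N]).
  by move=> f g fg; apply/ffunP => i; move/(congr1 (fun t => tnth t i)): fg; rewrite !tnth_mktuple.
rewrite (_ : [set _ | _]%SET = [set [tuple f i | i < N] | f : {ffun 'I_N -> A} in family F]%SET).
  by rewrite card_imset// card_family foldrE big_map big_enum.
apply/setP => t; rewrite inE; apply/forallP/imsetP => [tF|[f /familyP fF -> i]].
  exists [ffun i => tnth t i]; first by apply/familyP => i; rewrite ffunE.
  by apply: eq_from_tnth => i; rewrite tnth_mktuple ffunE.
by rewrite tnth_mktuple.
Qed.

Lemma sum_prod_tuple (R : comPzSemiRingType) (A : finType) l (F : A -> R) :
  \sum_(t : l.-tuple A) \prod_(a <- t) F a = (\sum_a F a) ^+ l.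
Proof.
rewrite -[in RHS](card_ord l) -prodr_const (bigA_distr_bigA (fun _ a => F a)) /=.
rewrite (reindex (fun f : {ffun 'I_l -> A} => [tuple f i | i < l])) /=.
  by apply: eq_bigr => f _; rewrite /= big_map big_enum.
exists (fun t => [ffun i => tnth t i]) => [f _|t _].
  by apply/ffunP => i; rewrite ffunE tnth_mktuple.
by apply: eq_from_tnth => i; rewrite tnth_mktuple ffunE.
Qed.

End Counting.

Section PrefixCount.
Context {R : realType}.

(** By [affine_separated] for whole words, distinct words give points at distance at least
    [lam ^+ l * rho]. The allowed deviation scales by the same factor, so [C] does not depend on the
    level. *)
Lemma card_words (A : finType) (f : A -> R -> R) (lam : R) (V : set R)
    (W : pred A) (e : rel A) l (P : {set l.-tuple A}) (u rho p L : R) (C : nat) :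
  0 < lam -> (forall a, affine lam (f a)) ->
  (forall a x, W a -> V x -> V (f a x)) ->
  (forall a b x y, W a -> W b -> e a b -> a != b -> V x -> V y -> f a x <> f b y) ->
  ball u rho `<=` V -> 0 < rho -> 2 * L < C%:R * rho ->
  (forall t, t \in P -> all W t) ->
  (forall t t', t \in P -> t' \in P -> all2 e t t') ->
  (forall t, t \in P -> `|foldr f u t - p| <= L * lam ^+ l) ->
  (#|P| <= C)%N.
Proof.
move=> lam0 faff fV disj ballV rho0 LC PW Pe PL.
apply: (@card_separated _ _ _ (fun t : l.-tuple A => foldr f u t) p
  (lam ^+ l * rho) (L * lam ^+ l)).
- by rewrite mulr_gt0 ?exprn_gt0.
- by rewrite mulrA [lam ^+ l * rho]mulrC (mulrA C%:R) ltr_pM2r ?exprn_gt0.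
- exact: PL.
- move=> t t' tP t'P tt'.
  have affl (s : l.-tuple A) : affine (lam ^+ l) (fun x => foldr f x s).
    by rewrite -[X in _ ^+ X](size_tuple s); exact: affine_foldr.
  apply: (affine_separated (exprn_gt0 l lam0) (affl t) (affl t') ballV) => //.
  by apply: (foldr_disjoint lam0 faff fV disj); rewrite ?PW ?Pe.
Qed.

Context (A B : finType) (row : A -> B) (Rf : nat) (f : A -> R -> R) (h : B -> R -> R).
Context (a b : R) (U V : set R) (u v rho L : R) (z : R * R) (C : nat).
Hypotheses (a_gt0 : 0 < a) (b_gt0 : 0 < b).
Hypotheses (faff : forall x, affine a (f x)) (haff : forall y, affine b (h y)).
Hypotheses (fV : forall x s, V s -> V (f x s)).
Hypotheses (fdisj : forall x y s t, row x = row y -> x != y -> V s -> V t -> f x s <> f y t).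
Hypotheses (hU : forall x s, U s -> U (h (row x) s)).
Hypotheses (hdisj : forall x y s t, row x != row y -> U s -> U t -> h (row x) s <> h (row y) t).
Hypotheses (ballV : ball u rho `<=` V) (ballU : ball v rho `<=` U) (rho_gt0 : 0 < rho).
Hypothesis zL : forall w : seq A,
  `|foldr f z.1 w - u| <= L /\ `|foldr h z.2 (map row w) - v| <= L.
Hypothesis LC : 2 * (L + 1) < C%:R * rho.
Hypothesis fibre : forall y, (#|[set x | row x == y]%SET| <= Rf)%N.

(** The height of the ball leaves at most [C] choices for the first [k] rows, and then its width at
    most [C] for the first [l] letters. Each letter from [l] to [k] has a prescribed row, hence [Rf]
    choices; the last [N - k] are free. *)
Lemma card_words_in_ball (p : R * R) (r : R) k l N :
  (l <= k)%N -> (k <= N)%N -> r <= a ^+ l -> r <= b ^+ k ->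
  (#|[set w : N.-tuple A | `[< ball p r (foldr f z.1 w, foldr h z.2 (map row w)) >]]%SET|
     <= C * (C * (Rf ^ (k - l) * #|A| ^ (N - k))))%N.
Proof.
move=> lk kN ral rbk; set X := [set _ | _]%SET.
have lN := leq_trans lk kN.
(* Replacing the tail point by the reference point costs [L], and the radius of the ball costs 1, in
   units of [lam ^+ j]; hence the constant [L + 1]. *)
have near (lam s s' t u' : R) g j : affine (lam ^+ j) g -> 0 < lam -> r <= lam ^+ j ->
    `|s - t| < r -> t = g s' -> `|s' - u'| <= L -> `|g u' - s| <= (L + 1) * lam ^+ j.
  move=> gaff lam0 rj st tE s'L; rewrite distrC (le_trans (ler_distD t _ _))//.
  rewrite mulrDl mul1r addrC lerD//; last exact: le_trans (ltW st) _.
  by rewrite tE (affine_dist _ _ gaff) mulrC ler_wpM2r// exprn_ge0// ltW.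
apply: (card_le_fibres (g := fun w : N.-tuple A => [tuple of map row (take k w)])).
  apply: (@card_words B h b U [pred y | y \in codom row] (fun _ _ => true)
    (minn k N) _ v rho p.2 (L + 1)) => //.
  - by move=> _ s /codomP[x ->]; exact: hU.
  - by move=> _ _ s t /codomP[x ->] /codomP[y ->] _; exact: hdisj.
  - move=> t /imsetP[w _ ->] /=; apply/allP => y /mapP[x _ ->]; exact: codom_f.
  - move=> t t' _ _; rewrite all2E !size_tuple eqxx/=.
    by apply/allP.
  - move=> _ /imsetP[w + ->] /=; rewrite inE => /asboolP[/= _ wp].
    have szk : size (map row (take k w)) = minn k N by rewrite size_map size_take_min size_tuple.
    apply: (near b p.2 (foldr h z.2 (map row (drop k w))) (foldr h z.2 (map row w)) v
       (fun x => foldr h x (map row (take k w)))) => //.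
    + by rewrite -szk; exact: affine_foldr.
    + by rewrite (minn_idPl kN).
    + by rewrite -foldr_cat -map_cat cat_take_drop.
    + by have [] := zL (drop k w).
move=> s _; set Y := [set _ in X | _]%SET.
apply: (card_le_fibres (g := fun w : N.-tuple A => [tuple of take l w])).
  (* Within one fibre the row prefixes agree, so letters are compared only inside a common row,
     where [fdisj] applies. *)
  apply: (@card_words A f a V xpredT (fun x y => row x == row y)
    (minn l N) _ u rho p.1 (L + 1)) => //.
  - by move=> x s' _; exact: fV.
  - by move=> x y t t' _ _ /eqP; exact: fdisj.
  - by move=> t _; apply/allP.
  - move=> _ _ /imsetP[w + ->] /imsetP[w' + ->]; rewrite !inE => /andP[_ /eqP ws] /andP[_ /eqP w's].
    apply: all2_map_eq => /=.
    rewrite -(take_takel w lk) -(take_takel w' lk) !map_take -!(map_take k).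
    by have /= -> := congr1 val ws; have /= -> := congr1 val w's.
  - move=> _ /imsetP[w + ->] /=; rewrite !inE => /andP[/asboolP[/= wp _] _].
    have szl : size (take l w) = minn l N by rewrite size_take_min size_tuple.
    apply: (near a p.1 (foldr f z.1 (drop l w)) (foldr f z.1 w) u
       (fun x => foldr f x (take l w))) => //.
    + by rewrite -szl; exact: affine_foldr.
    + by rewrite (minn_idPl lN).
    + by rewrite -foldr_cat cat_take_drop.
    + by have [] := zL (drop l w).
move=> d /imsetP[w0 _ dE].
pose F (i : 'I_N) := if (i < l)%N then [set tnth w0 i]%SET
  else if (i < k)%N then [set x | Some (row x) == onth s i]%SET else finset.setT.
apply: (@leq_trans #|[set t : N.-tuple A | [forall i, tnth t i \in F i]]%SET|).
  apply: subset_leq_card; apply/fintype.subsetP => w.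
  rewrite 4!inE => /andP[/andP[_ /eqP ws] /eqP wd].
  apply/forallP => i; rewrite /F; case: ifPn => il.
    have x0 := tnth w i.
    rewrite inE; apply/eqP; rewrite !(tnth_nth x0) -(nth_take x0 il w) -(nth_take x0 il w0).
    by have := wd; rewrite dE => /(congr1 val)/= ->.
  case: ifPn => ik; rewrite inE// -ws onthE/= !map_take nth_take// -map_comp.
  have x0 := tnth w i.
  by rewrite (nth_map x0) ?size_tuple//= (tnth_nth x0).
rewrite card_tuple_family (leq_trans (n := (\prod_(i < N) if (i < l)%N then 1
  else if (i < k)%N then Rf else #|A|)%N))//.
  apply: leq_prod => i _; rewrite /F; case: ifP => _; first by rewrite cards1.
  case: ifP => _; last by rewrite cardsT.
  case: (onth s i) => [y|].
    by rewrite -(eq_card (A := [set x | row x == y]%SET)) ?fibre// => x; rewrite !inE.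
  by rewrite (_ : [set _ | _]%SET = finset.set0) ?cards0//; apply/setP => x; rewrite !inE.
rewrite -(big_mkord xpredT (fun i => if (i < l)%N then 1 else if (i < k)%N then Rf else #|A|)%N).
rewrite (@big_cat_nat _ _ _ l 0%N)//= (@big_cat_nat _ _ _ k l)//=.
rewrite big1_seq ?mul1n; last by move=> i /=; rewrite mem_index_iota => /= ->.
rewrite (@eq_big_nat _ _ _ l k _ (fun=> Rf)); last first.
  by move=> i /andP[li ik]; rewrite ltnNge li ik.
rewrite (@eq_big_nat _ _ _ k N _ (fun=> #|A|)); last first.
  by move=> i /andP[ki iN]; rewrite !ltnNge ki (leq_trans lk ki).
by rewrite !prod_nat_const_nat.
Qed.

End PrefixCount.

(** * Lower bound for homogeneous systems *)

Section Homogeneous.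
Context {R : realType}.

Lemma exists_expr_lt (b r : R) : 0 < b < 1 -> 0 < r -> exists k, b ^+ k < r.
Proof.
move=> /andP[b0 b1] r0; have nb1 : `|b| < 1 by rewrite ger0_norm ?ltW.
have /cvgrPdist_lt h := cvg_expr nb1.
have [k _ /(_ k (leqnn k))] := h r r0.
by rewrite /= sub0r normrN normrX ger0_norm ?ltW//; exists k.
Qed.

Lemma exists_expr_bracket (b r : R) : 0 < b < 1 -> 0 < r <= 1 ->
  exists k, b ^+ k.+1 < r <= b ^+ k.
Proof.
move=> b01 /andP[r0 r1]; case: (ex_minnP (exists_expr_lt b01 r0)) => -[|k].
  by rewrite expr0 ltNge r1.
move=> bk mink; exists k; rewrite bk leNgt /=; apply/negP => /mink.
by rewrite ltnn.
Qed.

Lemma compact_plane_bounded (K : set (R * R)) : compact K ->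
  exists L, forall p, K p -> `|p.1| <= L /\ `|p.2| <= L.
Proof.
move=> cK; have [M [_ MK]] : bounded_set (K : set (R^o * R^o)) by exact: compact_bounded.
exists (M + 1) => p Kp; have := MK (M + 1) _ p Kp; rewrite ltrDl ltr01 => /(_ isT).
by rewrite /= prod_normE/= ge_max => /andP.
Qed.

(* The equations on [b] and [a] say that [s1] and [s2] are the similarity
   dimensions of the row words and of the digit words above one row word. *)
Lemma homogeneous_lower_bound (A B : finType) (row : A -> B) (Rf tau : nat)
    (f : A -> R -> R) (h : B -> R -> R) (a b : R) (U V : set R) (u v rho : R)
    (K : set (R * R)) (s1 s2 : R) :
  0 < a -> a <= b -> b < 1 ->
  (forall x, affine a (f x)) -> (forall y, affine b (h y)) ->
  (forall x s, V s -> V (f x s)) ->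
  (forall x y s t, row x = row y -> x != y -> V s -> V t -> f x s <> f y t) ->
  (forall x s, U s -> U (h (row x) s)) ->
  (forall x y s t, row x != row y -> U s -> U t -> h (row x) s <> h (row y) t) ->
  ball u rho `<=` V -> ball v rho `<=` U -> 0 < rho ->
  (forall y, (#|[set x | row x == y]%SET| <= Rf)%N) ->
  #|A| = (tau * Rf)%N -> (0 < #|A|)%N ->
  0 <= s1 -> 0 <= s2 -> b `^ s1 = tau%:R^-1 -> a `^ s2 = Rf%:R^-1 ->
  compact K -> K !=set0 -> (forall x p, K p -> K (f x p.1, h (row x) p.2)) ->
  exists2 c : R, 0 < c & forall t delta, 0 <= t <= s1 + s2 ->
    (c%:E <= hausdorff_premeasure t delta K)%E.
Proof.
move=> a0 ab b1 faff haff fV fdisj hU hdisj ballV ballU rho0 fibre cardA A0 s10 s20 bs1 as2.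
move=> cK [z Kz] Kstable.
have b0 := lt_le_trans a0 ab; have a1 := le_lt_trans ab b1.
have Kw (w : seq A) : K (foldr f z.1 w, foldr h z.2 (map row w)).
  elim: w => [|x w IH] /=; first by case: (z) Kz.
  exact: (Kstable x _ IH).
have [L0 KL0] := compact_plane_bounded cK.
pose L := L0 + `|u| + `|v|.
have zL w : `|foldr f z.1 w - u| <= L /\ `|foldr h z.2 (map row w) - v| <= L.
  have [/= h1 h2] := KL0 _ (Kw w); rewrite /L; split.
    by rewrite (le_trans (ler_normB _ _))// -addrA lerD// lerDl.
  by rewrite (le_trans (ler_normB _ _))// lerD2r (le_trans h2)// lerDl.
have L0' : 0 <= L by have [/(le_trans (normr_ge0 _))] := zL [::].
pose C := (Num.truncn (2 * (L + 1) / rho)).+1.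
have LC : 2 * (L + 1) < C%:R * rho by rewrite -ltr_pdivrMr// truncnS_gt.
move: (A0); rewrite cardA muln_gt0 => /andP[tau0 Rf0].
(* The factor [tau * Rf] pays for the exponents [k.+1] and [l.+1], which appear because [r] is only
   bracketed between consecutive powers. *)
pose Ct : R := (C * (C * (tau * Rf)))%:R.
have Ct1 : 1 <= Ct by rewrite /Ct ler1n !muln_gt0 tau0 Rf0.
exists Ct^-1; first by rewrite invr_gt0 (lt_le_trans ltr01).
move=> t delta /andP[t0 ts].
apply: (@mass_distribution _ K t Ct delta (fun N => N.-tuple A : finType)
  (fun N w => (foldr f z.1 w, foldr h z.2 (map row w)))) => //.
- exact: lt_le_trans Ct1.
- by move=> N; rewrite card_tuple expn_gt0 A0.
(* A radius of at least 1 has [r ^ t >= 1], so the total number of words is bound enough. *)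
move=> p r r0; have [r1|r1] := leP 1 r.
  exists 0%N => N _; apply: (@le_trans _ _ #|{: N.-tuple A}|%:R).
    by rewrite ler_nat max_card.
  rewrite mulrAC ler_peMl// mulr_ege1//.
  by rewrite -(powRr0 r) ler_powR.
have a01 : 0 < a < 1 by rewrite a0.
have b01 : 0 < b < 1 by rewrite b0.
have r01 : 0 < r <= 1 by rewrite r0 ltW.
have [k /andP[bk rk]] := @exists_expr_bracket b r b01 r01.
have [l /andP[al rl]] := @exists_expr_bracket a r a01 r01.
(* From [a <= b] comes [b ^+ k.+1 < r <= a ^+ l <= b ^+ l]. *)
have lk : (l <= k)%N.
  rewrite -ltnS; have := lt_le_trans bk rl => bal.
  have : b ^+ k.+1 < b ^+ l by rewrite (lt_le_trans bal)// lerXn2r ?nnegrE ?(ltW a0) ?(ltW b0).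
  by rewrite ltr_iXn2l.
exists k => N kN.
have := card_words_in_ball a0 b0 faff haff fV fdisj hU hdisj
  ballV ballU rho0 zL LC fibre p lk kN rl rk.
rewrite -(ler_nat R) => /le_trans; apply.
have tau0' : 0 < tau%:R :> R by rewrite ltr0n.
have Rf0' : 0 < Rf%:R :> R by rewrite ltr0n.
have h1 : tau%:R ^- k.+1 <= r `^ s1.
  apply: (@le_trans _ _ ((b ^+ k.+1) `^ s1)).
    by rewrite -powR_mulrn ?(ltW b0)// powRAC bs1 powR_mulrn ?invr_ge0// exprVn.
  by apply: ge0_ler_powR => //; rewrite ?nnegrE ?exprn_ge0 ?ltW.
have h2 : Rf%:R ^- l.+1 <= r `^ s2.
  apply: (@le_trans _ _ ((a ^+ l.+1) `^ s2)).
    by rewrite -powR_mulrn ?(ltW a0)// powRAC as2 powR_mulrn ?invr_ge0// exprVn.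
  by apply: ge0_ler_powR => //; rewrite ?nnegrE ?exprn_ge0 ?ltW.
have h3 : tau%:R ^- k.+1 * Rf%:R ^- l.+1 <= r `^ t.
  apply: (le_trans (ler_pM _ _ h1 h2)); rewrite ?invr_ge0 ?exprn_ge0//.
  rewrite -powRD; last by rewrite (gt_eqF r0) implybT.
  by apply: ger_powR => //; rewrite r0 ltW.
rewrite /Ct card_tuple !natrM -!mulrA ler_wpM2l// ler_wpM2l//.
rewrite cardA -(subnK kN) addnK expnD natrM.
apply: (@le_trans _ _ (tau%:R * (Rf%:R * (((tau * Rf) ^ (N - k))%:R * ((tau * Rf) ^ k)%:R *
   (tau%:R ^- k.+1 * Rf%:R ^- l.+1))))); last by rewrite !ler_wpM2l// mulr_ge0.
have Rfk : Rf%:R ^+ k = Rf%:R ^+ (k - l) * Rf%:R ^+ l :> R by rewrite -exprD subnK.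
rewrite !natrX natrM !exprMn !exprS Rfk.
rewrite le_eqVlt; apply/orP; left; apply/eqP; field.
by rewrite !expf_neq0 ?gt_eqF.
Qed.

End Homogeneous.

(** * Column and row branches of the carpet *)

Section CarpetMaps.
Context {R : realType} {n m : nat}.
Variables (D : {set 'I_n * 'I_m}) (sigma eta : 'I_n * 'I_m -> bool).
Hypotheses (n_gt0 : (0 < n)%N) (m_gt0 : (0 < m)%N).
Implicit Types (d : 'I_n * 'I_m) (b : 'I_m * bool).

Definition digit_row d : 'I_m * bool := (d.2, eta d).

Definition column_branch d (x : R) : R :=
  (sign_val R (sigma d) * x + sign_shift (sigma d) d.1) / n%:R.

Lemma carpet_mapE d (p : R * R) :
  carpet_map sigma eta d p = (column_branch d p.1, row_branch (digit_row d) p.2).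
Proof.
congr pair; rewrite /row_branch /sign_val /sign_shift /=; case: (eta d).
  by rewrite mul1r.
by rewrite mulN1r addrC.
Qed.

Lemma affine_column_branch d : affine n%:R^-1 (column_branch d).
Proof.
exists (sign_val R (sigma d) / n%:R).
  rewrite normrM normfV normr_nat /sign_val.
  by case: (sigma d); rewrite ?normrN normr1 mul1r.
by exists (sign_shift (sigma d) d.1 / n%:R) => x; rewrite /column_branch mulrDl mulrAC.
Qed.

Lemma affine_row_branch b : affine m%:R^-1 (@row_branch R m b).
Proof.
rewrite /row_branch; case: b => j [] /=.
  exists m%:R^-1; first by rewrite normfV normr_nat.
  by exists (j%:R / m%:R) => y; rewrite mulrDl mulrC.
exists (- m%:R^-1); first by rewrite normrN normfV normr_nat.
by exists (j.+1%:R / m%:R) => y; rewrite mulrBl mulNr addrC mulrC.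
Qed.

(** Either orientation sends the open unit interval into the open column [d.1], so this interval
    serves as the separating open set horizontally. *)
Lemma column_branch_itv d (x : R) : 0 < x < 1 ->
  d.1%:R < n%:R * column_branch d x < d.1.+1%:R.
Proof.
move=> /andP[x0 x1]; rewrite /column_branch mulrC divfK ?pnatr_eq0 -?lt0n//.
by rewrite /sign_val /sign_shift -natr1; case: (sigma d); apply/andP; split; lra.
Qed.

Lemma column_branch_stable d (x : R) : 0 < x < 1 -> 0 < column_branch d x < 1.
Proof.
have n0 : 0 < n%:R :> R by rewrite ltr0n.
move=> /(column_branch_itv d)/andP[h1 h2].
rewrite -(pmulr_rgt0 _ n0) (le_lt_trans _ h1)//= -(ltr_pM2l n0) mulr1.
by rewrite (lt_le_trans h2)// ler_nat ltn_ord.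
Qed.

Lemma column_branch_disjoint d d' (x y : R) : digit_row d = digit_row d' -> d != d' ->
  0 < x < 1 -> 0 < y < 1 -> column_branch d x <> column_branch d' y.
Proof.
move=> [d2 _] dd' /(column_branch_itv d)/andP[h1 h2] /(column_branch_itv d')/andP[h3 h4] dxy.
rewrite dxy in h1 h2; have := lt_trans h1 h4; have := lt_trans h3 h2.
rewrite !ltr_nat !ltnS => le1 le2; move/eqP: dd'; apply.
rewrite (surjective_pairing d) (surjective_pairing d') d2; congr pair.
by apply/val_inj/eqP; rewrite eqn_leq le1 le2.
Qed.

Lemma card_digits_in_row b : #|[set d in D | digit_row d == b]%SET| = row_count D eta b.
Proof.
have inj : injective (fun i : 'I_n => (i, b.1)) by move=> i j [].
rewrite /row_count -(card_imset _ inj); apply: eq_card => d; rewrite inE.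
apply/andP/imsetP => [[dD /eqP db]|[i + ->]].
  exists d.1; rewrite ?inE -db -?surjective_pairing//.
  by rewrite dD eqxx.
by rewrite inE => /andP[iD /eqP ib]; rewrite iD /digit_row/= ib -surjective_pairing.
Qed.

Lemma digit_row_in_branches d : d \in D -> digit_row d \in row_branches D eta.
Proof.
by move=> dD; rewrite inE -card_digits_in_row card_gt0; apply/set0Pn; exists d; rewrite !inE dD/=.
Qed.

Lemma card_digit_words q (s : q.-tuple ('I_m * bool)) :
  #|[set w : q.-tuple ('I_n * 'I_m) | all (fun d => d \in D) w &&
     (map_tuple digit_row w == s)]%SET| = (\prod_(b <- s) row_count D eta b)%N.
Proof.
rewrite big_tuple; under eq_bigr do rewrite -card_digits_in_row.
rewrite -card_tuple_family; apply: eq_card => w; rewrite !inE.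
apply/andP/forallP => [[/all_tnthP wD /eqP ws] i|ws].
  by rewrite inE wD -ws tnth_map /=.
split; first by apply/all_tnthP => i; have := ws i; rewrite inE => /andP[].
by apply/eqP/eq_from_tnth => i; have := ws i; rewrite inE tnth_map => /andP[_ /eqP].
Qed.

(* Words with equal letter counts carry equal products of row counts; one of the
   at most [(q + 1) ^ (2 m)] types must carry its share of [Z ^+ q]. *)
Lemma heavy_type (beta : R) q :
  let Z := \sum_(b in row_branches D eta) (row_count D eta b)%:R `^ beta in
  0 < Z ->
  exists (T : {set q.-tuple ('I_m * bool)}) (Rf : nat),
  [/\ (0 < #|T|)%N, (0 < Rf)%N,
      forall s, s \in T -> all (fun b => b \in row_branches D eta) s,
      forall s, s \in T -> (\prod_(b <- s) row_count D eta b)%N = Rf &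
      Z ^+ q <= (q.+1 ^ (m * 2))%:R * (#|T|%:R * Rf%:R `^ beta)].
Proof.
move=> Z Z0.
(* Extending the weights by zero turns [Z ^+ q] into a sum over all tuples; the words later
   discarded from the class [T] are exactly of weight zero. *)
pose G b := if b \in row_branches D eta then (row_count D eta b)%:R `^ beta else 0 : R.
pose wt (s : q.-tuple _) := \prod_(b <- s) G b.
pose type (s : q.-tuple ('I_m * bool)) : {ffun 'I_m * bool -> 'I_q.+1} :=
  [ffun b => inord (count_mem b s)].
have typeE s s' : type s = type s' -> perm_eq s s'.
  have count_le b (t : q.-tuple ('I_m * bool)) : (count_mem b t < q.+1)%N.
    by rewrite ltnS -[leqRHS](size_tuple t) count_size.
  move=> ss'; apply/allP => b _ /=.
  have := congr1 (fun g : {ffun 'I_m * bool -> 'I_q.+1} => nat_of_ord (g b)) ss'.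
  by rewrite !ffunE !inordK// => ->.
have wt0 s : 0 <= wt s.
  by apply: prodr_ge0 => b _; rewrite /G; case: ifP => _; rewrite ?powR_ge0.
have ZE : Z ^+ q = \sum_s wt s.
  by rewrite /wt sum_prod_tuple /Z big_mkcond.
pose S ty := \sum_(s | type s == ty) wt s.
pose ty0 := [arg max_(ty > type [tuple of nseq q (Ordinal m_gt0, true)]) S ty]%O.
have Smax ty : S ty <= S ty0.
  by rewrite /ty0; case: arg_maxP => // i _ /(_ ty isT).
have ZS : Z ^+ q <= (q.+1 ^ (m * 2))%:R * S ty0.
  rewrite ZE (partition_big type xpredT)//=.
  apply: (le_trans (ler_sum _ (fun ty _ => Smax ty))).
  by rewrite sumr_const card_ffun card_prod !card_ord card_bool mulr_natl.
have S0 : 0 < S ty0.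
  rewrite -(pmulr_rgt0 _ (_ : 0 < (q.+1 ^ (m * 2))%:R)) ?ltr0n ?expn_gt0//.
  by rewrite (lt_le_trans _ ZS)// exprn_gt0.
pose T := [set s | (type s == ty0) && all (fun b => b \in row_branches D eta) s]%SET.
have wtT s : s \in T -> wt s = (\prod_(b <- s) row_count D eta b)%:R `^ beta.
  rewrite inE => /andP[_ /allP sB]; rewrite /wt.
  have -> : \prod_(b <- s) G b = \prod_(b <- s) (row_count D eta b)%:R `^ beta.
    by apply: eq_big_seq => b /sB; rewrite /G => ->.
  elim: (tval s) => [|b s' IH]; first by rewrite !big_nil powR1.
  by rewrite !big_cons IH natrM powRM.
have SE : S ty0 = \sum_(s in T) wt s.
  rewrite /S (bigID (mem T))/= [X in _ + X]big1 ?addr0.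
    apply: eq_bigl => s; rewrite inE; by case: eqP.
  move=> s /andP[sty]; rewrite inE sty /= => /allPn[b bs bB].
  by rewrite /wt (perm_big _ (perm_to_rem bs)) big_cons /G (negPf bB) /= mul0r.
have [T0|[s0 s0T]] := set_0Vmem T.
  by move: S0; rewrite SE T0 big_set0 ltxx.
exists T, (\prod_(b <- s0) row_count D eta b)%N.
have Teq s : s \in T ->
    (\prod_(b <- s) row_count D eta b)%N = (\prod_(b <- s0) row_count D eta b)%N.
  move=> sT; apply: perm_big; apply: typeE.
  by move: sT s0T; rewrite !inE => /andP[/eqP -> _] /andP[/eqP -> _].
split => //.
- by rewrite card_gt0; apply/set0Pn; exists s0.
- rewrite big_seq prodn_cond_gt0// => b bs; move: s0T; rewrite inE => /andP[_ /allP/(_ _ bs)].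
  by rewrite inE.
- by move=> s; rewrite inE => /andP[].
- rewrite (le_trans ZS)// SE (eq_bigr (fun=> (\prod_(b <- s0) row_count D eta b)%:R `^ beta)).
    by rewrite sumr_const -[X in _ * X <= _]mulr_natl.
  by move=> s sT; rewrite wtT// Teq.
Qed.

End CarpetMaps.

(** * Lower bound *)

Section Lower.
Context {R : realType} {n m : nat}.
Variables (D : {set 'I_n * 'I_m}) (sigma eta : 'I_n * 'I_m -> bool) (K : set (R * R)).
Hypotheses (m_ge2 : (2 <= m)%N) (m_lt_n : (m < n)%N) (D_neq0 : D != finset.set0).
Hypothesis K_attractor : is_attractor D (carpet_map sigma eta) K.

Let m_gt0 : (0 < m)%N := ltnW m_ge2.
Let n_gt0 : (0 < n)%N := ltn_trans m_gt0 m_lt_n.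
Let beta : R := ln m%:R / ln n%:R.
Let Z : R := \sum_(b in row_branches D eta) (row_count D eta b)%:R `^ beta.

Lemma ln_m_gt0 : 0 < ln m%:R :> R.
Proof. by rewrite ln_gt0// ltr1n. Qed.

Lemma ln_n_gt0 : 0 < ln n%:R :> R.
Proof. by rewrite ln_gt0// ltr1n (ltn_trans m_ge2). Qed.

Lemma beta_gt0 : 0 < beta.
Proof. by rewrite divr_gt0 ?ln_m_gt0 ?ln_n_gt0. Qed.

Lemma row_sum_ge1 : 1 <= Z.
Proof.
have /set0Pn[d dD] := D_neq0.
have bB := digit_row_in_branches eta dD.
rewrite /Z (bigD1 (digit_row eta d))//=.
rewrite (le_trans (y := (row_count D eta (digit_row eta d))%:R `^ beta))//.
  have r1 : 1 <= (row_count D eta (digit_row eta d))%:R :> R.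
    by rewrite ler1n; move: bB; rewrite inE.
  by have := ler_powR r1 (ltW beta_gt0); rewrite powRr0.
by rewrite lerDl sumr_ge0// => b _; rewrite powR_ge0.
Qed.

Lemma attractor_carpet_map d p : d \in D -> K p -> K (carpet_map sigma eta d p).
Proof.
move=> dD Kp; case: K_attractor => _ _ ->.
by exists d => //; exists p.
Qed.

(** Shows that the exponents [s1] and [s2] of a block system solve the equations required by
    [homogeneous_lower_bound]. *)
Lemma powR_exprVn (M q : nat) (x : R) : (0 < q)%N -> (1 < M)%N -> 0 < x ->
  (M%:R^-1 ^+ q) `^ (ln x / (q%:R * ln M%:R)) = x^-1.
Proof.
move=> q0 M1 x0; have M0 : 0 < M%:R :> R by rewrite ltr0n ltnW.
have lnM0 : 0 < ln M%:R :> R by rewrite ln_gt0// ltr1n.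
rewrite /powR gt_eqF ?exprn_gt0 ?invr_gt0// lnXn ?invr_gt0// lnV ?posrE//.
rewrite -[X in expR X](_ : - ln x = _) ?expRN ?lnK//.
by rewrite -mulr_natl; field; rewrite (gt_eqF lnM0) pnatr_eq0 -lt0n q0.
Qed.

(** The digit words above a heavy type form a homogeneous system of ratios [n ^ -q] and [m ^ -q].
    Vanishing measure forces [s1 + s2 < t], while [q ln m (s1 + s2) = ln #|T| + beta ln Rf], which
    is [ln (Z ^ q)] up to the type-counting loss. *)
Lemma block_lower_bound q t : open_set_condition (row_branches D eta) (@row_branch R m) ->
  (0 < q)%N -> 0 <= t -> hausdorff_measure t K = 0%E ->
  q%:R * ln Z - (m * 2)%:R * ln q.+1%:R <= q%:R * t * ln m%:R.
Proof.
move=> [U [[v Uv] _ oU Ustable Udisj]] q0 t0 Kt0.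
have [rho rho0 ballU] : exists2 rho : R, 0 < rho & ball v rho `<=` U.
  have /nbhs_ballP[rho /= rho0 h] : nbhs v U by exact: open_nbhs_nbhs.
  by exists rho.
have Z0 : 0 < Z := lt_le_trans ltr01 row_sum_ge1.
have [T [Rf [T0 Rf0 TB TR ZT]]] := heavy_type m_gt0 q Z0.
pose P (w : q.-tuple ('I_n * 'I_m)) :=
  all (fun d => d \in D) w && (map_tuple (digit_row eta) w \in T).
pose A : finType := {w | P w}.
pose row (w : A) := map_tuple (digit_row eta) (val w).
pose f (w : A) (x : R) := foldr (column_branch sigma) x (val w).
pose h (s : q.-tuple ('I_m * bool)) (y : R) := foldr (@row_branch R m) y s.
pose V : set R := [set x | 0 < x < 1].
have cardP s : s \in T ->
    #|[set w : q.-tuple ('I_n * 'I_m) | all (fun d => d \in D) w &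
       map_tuple (digit_row eta) w == s]%SET| = Rf.
  by move=> sT; rewrite card_digit_words TR.
have fibre s : (#|[set w : A | row w == s]%SET| <= Rf)%N.
  have [sT|sT] := boolP (s \in T); last first.
    rewrite (_ : [set _ | _]%SET = finset.set0) ?cards0//.
    apply/setP => w; rewrite !inE; apply/negbTE; apply: contra sT => /eqP <-.
    by have /andP[] := valP w.
  rewrite -(cardP s sT) -(card_imset _ val_inj); apply: subset_leq_card.
  apply/fintype.subsetP => _ /imsetP[w + ->]; rewrite !inE => ->.
  by have /andP[->] := valP w.
have cardA : #|A| = (#|T| * Rf)%N.
  have -> : #|A| = (\sum_(w | P w) 1)%N by rewrite card_sig -sum1_card; apply: eq_bigl.
  rewrite (partition_big (map_tuple (digit_row eta)) (mem T))/=.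
    rewrite -sum_nat_const; apply: eq_bigr => s sT; rewrite -[RHS](cardP s sT) -sum1_card.
    apply: eq_bigl => w; rewrite !inE /P; case: eqP => [->|]; rewrite ?andbF// sT !andbT//.
  by move=> w /andP[].
have n0' : 0 < n%:R^-1 :> R by rewrite invr_gt0 ltr0n.
have m0' : 0 < m%:R^-1 :> R by rewrite invr_gt0 ltr0n.
have wD (w : A) : all (fun d => d \in D) (val w) by have /andP[] := valP w.
have wB (w : A) : all (fun b => b \in row_branches D eta) (row w).
  by apply: TB; have /andP[] := valP w.
have Ust b y : b \in row_branches D eta -> U y -> U (row_branch b y).
  by move=> bB Uy; apply: (Ustable b bB); exists y.
have Udj b c y z : b \in row_branches D eta -> c \in row_branches D eta -> b != c ->
    U y -> U z -> row_branch b y <> row_branch c z.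
  move=> bB cB bc Uy Uz yz; have := Udisj b c bB cB bc; apply/eqP/set0P.
  by exists (row_branch b y); split; [exists y|rewrite yz; exists z].
pose s1 : R := ln #|T|%:R / (q%:R * ln m%:R); pose s2 : R := ln Rf%:R / (q%:R * ln n%:R).
have q0' : 0 < q%:R :> R by rewrite ltr0n.
have lnT0 : 0 <= ln #|T|%:R :> R by rewrite ln_ge0// ler1n.
have lnRf0 : 0 <= ln Rf%:R :> R by rewrite ln_ge0// ler1n.
have lm0 := ln_m_gt0; have ln0 := ln_n_gt0.
have [c c0 Kc] : exists2 c : R, 0 < c & forall t delta, 0 <= t <= s1 + s2 ->
    (c%:E <= hausdorff_premeasure t delta K)%E.
  (* [V] is the ball of radius [2^-1] about [2^-1]; capping [rho] by that value gives one radius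
     valid for both [U] and [V]. *)
  apply: (@homogeneous_lower_bound R A _ row Rf #|T| f h (n%:R^-1 ^+ q) (m%:R^-1 ^+ q)
    U V 2^-1 v (Num.min rho 2^-1) K s1 s2) => //.
  - exact: exprn_gt0.
  - by rewrite lerXn2r ?nnegrE ?(ltW n0') ?(ltW m0')// lef_pV2 ?posrE ?ltr0n// ler_nat ltnW.
  - by rewrite exprn_ilt1 ?invf_lt1 ?ltr0n ?ltr1n -?lt0n// ltW.
  - move=> w; rewrite -[X in _ ^+ X](size_tuple (val w)).
    by apply: affine_foldr => d; exact: affine_column_branch.
  - move=> s; rewrite -[X in _ ^+ X](size_tuple s).
    by apply: affine_foldr => b; exact: affine_row_branch.
  - move=> w x Vx; apply: (@foldr_stable _ _ _ V (fun d => d \in D)) => // d y _.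
    exact: column_branch_stable.
  - move=> w w' x y ww' wNw' Vx Vy.
    apply: (@foldr_disjoint R _ (column_branch sigma) n%:R^-1 V (fun d => d \in D)
      (fun d d' => digit_row eta d == digit_row eta d')) => //.
    + exact: affine_column_branch.
    + by move=> d z _; exact: column_branch_stable.
    + by move=> d d' z z' _ _ /eqP; exact: column_branch_disjoint.
    + by apply: all2_map_eq; have /= := congr1 val ww'.
  - by move=> w y Uy; apply: (@foldr_stable _ _ _ U (fun b => b \in row_branches D eta)).
  - move=> w w' x y ww' Ux Uy.
    apply: (@foldr_disjoint R _ (@row_branch R m) m%:R^-1 U (fun b => b \in row_branches D eta)
      (fun _ _ => true)) => //.
    + exact: affine_row_branch.
    + by move=> b1 b2 z z' ? ? _; exact: Udj.
    + by rewrite all2E !size_tuple eqxx; apply/allP.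
  - move=> x; rewrite /ball /= lt_min => /andP[_]; rewrite ltr_norml => /andP[x1 x2].
    by apply/andP; split; lra.
  - by apply: subset_trans ballU; apply: le_ball; rewrite ge_min lexx.
  - by rewrite lt_min rho0 invr_gt0 ltr0n.
  - by rewrite cardA muln_gt0 T0.
  - by rewrite divr_ge0// mulr_ge0// ltW.
  - by rewrite divr_ge0// mulr_ge0// ltW.
  - by rewrite powR_exprVn// ?ltr0n// (ltn_trans m_ge2).
  - by rewrite powR_exprVn// ?ltr0n// (ltn_trans m_ge2).
  - by case: K_attractor.
  - by case: K_attractor.
  - move=> w p Kp; rewrite /f /h /row /=.
    elim: (tval (val w)) (wD w) => [|d w' IH] /=; first by case: (p) Kp.
    move=> /andP[dD w'D]; have := attractor_carpet_map dD (IH w'D).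
    by rewrite carpet_mapE.
have st : s1 + s2 < t.
  rewrite ltNge; apply/negP => ts.
  have := Kc t 1; rewrite t0 ts => /(_ isT); apply/negP; rewrite -ltNge.
  apply: (@le_lt_trans _ _ 0%E); last by rewrite lte_fin.
  by rewrite -Kt0; apply: ereal_sup_ubound; exists 1 => //=; exact: ltr01.
have T0' : 0 < #|T|%:R :> R by rewrite ltr0n.
have Rf0' : 0 < Rf%:R `^ beta by rewrite powR_gt0// ltr0n.
have qq0 : 0 < (q.+1 ^ (m * 2))%:R :> R by rewrite ltr0n expn_gt0.
move: ZT; rewrite -ler_ln ?posrE ?exprn_gt0 ?mulr_gt0// !lnM ?posrE ?mulr_gt0// ln_powR.
rewrite natrX !lnXn ?ltr0n// -[_ *+ q]mulr_natl -[_ *+ (m * 2)]mulr_natl => ZT.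
have -> : q%:R * t * ln m%:R = q%:R * ln m%:R * t by rewrite mulrAC.
rewrite lerBlDl (le_trans ZT)// lerD2l.
have -> : ln #|T|%:R + beta * ln Rf%:R = q%:R * ln m%:R * (s1 + s2).
  by rewrite /s1 /s2 /beta; field; rewrite !gt_eqF.
by rewrite ler_wpM2l ?mulr_ge0 ?ltW.
Qed.

(* Along [q = u ^ 2 - 1] the type-counting loss [ln (q + 1)] is at most [2 (u - 1)]. *)
Lemma carpet_lower_bound t : open_set_condition (row_branches D eta) (@row_branch R m) ->
  0 <= t -> hausdorff_measure t K = 0%E -> (ln m%:R)^-1 * ln Z <= t.
Proof.
move=> osc t0 Kt0; rewrite ler_pdivrMl ?ln_m_gt0// leNgt; apply/negP => tZ.
pose g := ln Z - ln m%:R * t.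
have g0 : 0 < g by rewrite subr_gt0.
(* As [q = (u - 1)(u + 1)], the factor [u - 1] cancels and leaves a right-hand side independent of
   [u]. *)
have key u : (1 < u)%N -> u.+1%:R * g <= (m * 4)%:R.
  move=> u1; have u1' : 0 < u%:R - 1 :> R by rewrite subr_gt0 ltr1n.
  have qE : ((u ^ 2).-1.+1 = u ^ 2)%N by rewrite prednK// expn_gt0 (ltnW u1).
  have := @block_lower_bound (u ^ 2).-1 t osc _ t0 Kt0.
  rewrite -ltnS qE (leq_trans (n := u))//; last by rewrite -[leqLHS]expn1 leq_exp2l.
  move=> /(_ isT); have -> : (u ^ 2).-1%:R = (u%:R - 1) * u.+1%:R :> R.
    by rewrite -[LHS](addrK 1) natr1 qE natrX -natr1; ring.
  rewrite natrX lnXn ?ltr0n ?(ltnW u1)// => H.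
  rewrite -(ler_pM2l u1'); have lnu : ln u%:R <= u%:R - 1 :> R.
    by rewrite -{1}(subrK 1 u%:R) addrC le_ln1Dx// (lt_trans (ltrN10 _)).
  rewrite mulrA; apply: (@le_trans _ _ ((m * 2)%:R * (ln u%:R *+ 2))).
    rewrite /g mulrBr -subr_ge0; move: H; rewrite -subr_ge0; congr (0 <= _); ring.
  have -> : (m * 2)%:R * (ln u%:R *+ 2) = (m * 4)%:R * ln u%:R :> R by rewrite !natrM; ring.
  by rewrite [leRHS]mulrC ler_wpM2l.
have [k hk] : exists k, (m * 4)%:R / g < k%:R.
  by exists (Num.truncn ((m * 4)%:R / g)).+1; exact: truncnS_gt.
have := key k.+2 isT; rewrite leNgt => /negP; apply.
rewrite -ltr_pdivrMr// (lt_trans hk)// ltr_nat; exact: leqW.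
Qed.

End Lower.

(** * Upper bound *)

Section Upper.
Context {R : realType}.

Lemma prod_weight (T : eqType) (P : pred T) (r : T -> nat) (c : R) (s : seq T) :
  (forall x, P x -> (0 < r x)%N) -> all P s ->
  \prod_(x <- s) (if P x then (r x)%:R `^ c else 0) = expR (c * \sum_(x <- s) ln (r x)%:R).
Proof.
move=> r0; elim: s => [|x s IH] /=; first by rewrite !big_nil mulr0 expR0.
move=> /andP[Px Ps]; rewrite !big_cons Px IH// mulrDr expRD /powR gt_eqF//.
by rewrite ltr0n r0.
Qed.

(* If the conclusion failed along the chain, the averages [S k / k] would drop
   by [e] at each step and become negative. *)
Lemma chain_good_step (S : nat -> R) (kappa : nat -> nat) (beta M e : R) (l0 J : nat) :
  0 < beta -> 0 < e -> M < J%:R * e -> (0 < l0)%N ->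
  (forall k, 0 <= S k <= M * k%:R) ->
  (forall l, (l <= kappa l)%N /\
     beta * (kappa l)%:R <= l%:R <= beta * (kappa l)%:R + beta) ->
  exists2 j, (j < J)%N & - (e * (iter j kappa l0)%:R + beta * M) <=
     beta * S (iter j.+1 kappa l0) - S (iter j kappa l0).
Proof.
move=> b0 e0 MJ l00 SM kap; apply: contrapT => nex.
have bad j : (j < J)%N -> beta * S (iter j.+1 kappa l0) - S (iter j kappa l0) <
    - (e * (iter j kappa l0)%:R + beta * M).
  by move=> jJ; rewrite ltNge; apply/negP => h; apply: nex; exists j.
have pos j : (0 < iter j kappa l0)%N.
  by elim: j => [//|j IH] /=; apply: (leq_trans IH); have [] := kap (iter j kappa l0).
have M0 : 0 <= M.
  by have /andP[h1 h2] := SM 1%N; move: (le_trans h1 h2); rewrite mulr1.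
have drop j : (j <= J)%N -> S (iter j kappa l0) <= (M - j%:R * e) * (iter j kappa l0)%:R.
  elim: j => [_|j IH jJ]; first by rewrite mul0r subr0; have /andP[] := SM (iter 0 kappa l0).
  have := bad _ jJ; have {IH} := IH (ltnW jJ).
  have [_] := kap (iter j kappa l0); rewrite !iterS -natr1.
  set k := (iter j kappa l0)%:R; set k' := (kappa (iter j kappa l0))%:R.
  set x := S (iter j kappa l0); set y := S (kappa (iter j kappa l0)).
  move=> /andP[h1 h2] h3 h4.
  rewrite -(ler_pM2l b0).
  set z := M - (j%:R + 1) * e.
  have zE : z = M - j%:R * e - e by rewrite /z; ring.
  have h5 : beta * y <= z * k - beta * M.
    by rewrite zE; lra.
  apply: (le_trans h5).
  (* The sign of [z] decides which side of the estimate for [kappa] is used: for [z >= 0] the excess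
     [z * beta] is absorbed by [beta * M]. *)
  have [z0|z0] := leP 0 z.
    have zM : z <= M by rewrite /z gerBl mulr_ge0 ?(ltW e0) ?addr_ge0.
    have : z * k <= z * (beta * k' + beta) by rewrite ler_wpM2l.
    have : z * beta <= M * beta by rewrite ler_wpM2r// ltW.
    by lra.
  have : z * k <= z * (beta * k') by rewrite ler_wnM2l// ltW.
  have : 0 <= beta * M by rewrite mulr_ge0// ltW.
  by lra.
have := drop J (leqnn J); rewrite leNgt => /negP; apply.
apply: (@lt_le_trans _ _ 0); last by have /andP[] := SM (iter J kappa l0).
by rewrite pmulr_llt0 ?ltr0n ?pos// subr_lt0.
Qed.

(** * Covers of the carpet by heavy approximate squares *)

Context {n m : nat}.
Variables (D : {set 'I_n * 'I_m}) (sigma eta : 'I_n * 'I_m -> bool) (K : set (R * R)).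
Hypotheses (m_ge2 : (2 <= m)%N) (m_lt_n : (m < n)%N) (D_neq0 : D != finset.set0).
Hypothesis K_attractor : is_attractor D (carpet_map sigma eta) K.

Let m_gt0 : (0 < m)%N := ltnW m_ge2.
Let n_gt0 : (0 < n)%N := ltn_trans m_gt0 m_lt_n.
Let beta : R := ln m%:R / ln n%:R.
Let B := row_branches D eta.
Let rc := row_count D eta.
Let Z : R := \sum_(b in B) (rc b)%:R `^ beta.
Let rows := map (digit_row eta).

Let rc_gt0 b : b \in B -> (0 < rc b)%N.
Proof. by rewrite inE. Qed.

Let drow_gt0 d : d \in D -> (0 < rc (digit_row eta d))%N.
Proof. by move=> dD; apply/rc_gt0/digit_row_in_branches. Qed.

(** The [rc b] digits above [b] share the weight [rc b ^ beta] equally, so digits and rows have the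
    same total weight. *)
Lemma sum_digit_weights :
  \sum_d (if d \in D then (rc (digit_row eta d))%:R `^ (beta - 1) else 0) = Z.
Proof.
rewrite -big_mkcond (partition_big (digit_row eta) (mem B))/=; last first.
  by move=> d dD; exact: digit_row_in_branches.
apply: eq_bigr => b bB; rewrite (eq_bigr (fun=> (rc b)%:R `^ (beta - 1))); last first.
  by move=> d /andP[_ /eqP ->].
have rb0 : 0 < (rc b)%:R :> R by rewrite ltr0n rc_gt0.
rewrite sumr_const powRB; last by rewrite (gt_eqF rb0) implybT.
rewrite powRr1 ?(ltW rb0)// -[LHS]mulr_natr; set k := #|_|.
suff -> : k = rc b by rewrite divfK ?gt_eqF.
by rewrite /k /rc -card_digits_in_row; apply: eq_card => d; rewrite !inE.
Qed.

(** Finite codings with a remaining point of [K] suffice, since the chain of levels has bounded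
    length. *)
Lemma attractor_coding N p : K p -> exists w q,
  [/\ size w = N, all (fun d => d \in D) w, K q & p = foldr (carpet_map sigma eta) q w].
Proof.
elim: N p => [|N IH] p Kp; first by exists [::], p.
have [d dD [p' Kp' pE]] : (\bigcup_(d in [set` D]) (carpet_map sigma eta d @` K)) p.
  by case: K_attractor => _ _ <-.
have [w [q [sw wD Kq p'E]]] := IH _ Kp'.
exists (d :: w), q; split => //=; first by rewrite sw.
  by rewrite wD andbT.
by rewrite -p'E pE.
Qed.

Lemma foldr_carpet_map (w : seq ('I_n * 'I_m)) (p : R * R) :
  foldr (carpet_map sigma eta) p w =
  (foldr (column_branch sigma) p.1 w, foldr (@row_branch R m) p.2 (rows w)).
Proof. by elim: w => [|d w IH] /=; [case: p|rewrite carpet_mapE IH]. Qed.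

(* Contains the approximate square with digit word [u] and further rows [v]. *)
Definition box (L : R) (u : seq ('I_n * 'I_m)) (v : seq ('I_m * bool)) : set (R * R) :=
  [set p | `|p.1 - foldr (column_branch sigma) 0 u| <= L * n%:R^-1 ^+ size u /\
           `|p.2 - foldr (@row_branch R m) 0 (rows u ++ v)|
              <= L * m%:R^-1 ^+ (size u + size v)].

(* The last clause bounds [beta * S k - S l] from below, for [l = size u] and
   [k = size u + size v]. *)
Definition heavy (c e : R) (u : seq ('I_n * 'I_m)) (v : seq ('I_m * bool)) : bool :=
  [&& all (fun d => d \in D) u, all (fun b => b \in B) v &
   - (e * (size u)%:R + c) <= beta * \sum_(b <- rows u ++ v) ln (rc b)%:R
      - \sum_(b <- rows u) ln (rc b)%:R].

Lemma diam_box L u v : 0 <= L -> n%:R^-1 ^+ size u <= m%:R^-1 ^+ (size u + size v) :> R ->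
  (diam (box L u v) <= (4 * L * m%:R^-1 ^+ (size u + size v))%:E)%E.
Proof.
move=> L0 nm; apply: diam_le => p q [p1 p2] [q1 q2].
apply: (le_trans (edist_le_sum _ _)).
set x := foldr _ _ _ in p1 q1; set y := foldr _ _ _ in p2 q2.
have := ler_distD x p.1 q.1; rewrite (distrC x) => h1.
have := ler_distD y p.2 q.2; rewrite (distrC y) => h2.
have := ler_wpM2l L0 nm.
by lra.
Qed.

(** A heavy box has its diameter power bounded by a multiple of its mass, and the masses add up to
    [Z ^ k]. The condition on [s] gains [exp (- 2 e k)], of which heaviness takes back [exp (e l)]
    with [l <= k]. *)
Lemma level_sum (L c e s : R) l k : 0 <= L -> 0 <= e -> 0 <= s -> (l <= k)%N ->
  n%:R^-1 ^+ l <= m%:R^-1 ^+ k :> R ->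
  ln Z + 2 * e <= s * ln m%:R ->
  (\sum_(u : l.-tuple ('I_n * 'I_m)) \sum_(v : (k - l).-tuple ('I_m * bool))
     diam_pow s (if heavy c e u v then box L u v else set0)
   <= ((4 * L) `^ s * expR c * expR (- (e * k%:R)))%:E)%E.
Proof.
move=> L0 e0 s0 lk nm es.
pose G1 d := if d \in D then (rc (digit_row eta d))%:R `^ (beta - 1) else 0 : R.
pose G2 b := if b \in B then (rc b)%:R `^ beta else 0 : R.
pose A : R := (4 * L * m%:R^-1 ^+ k) `^ s * expR (e * l%:R + c).
have G10 d : 0 <= G1 d by rewrite /G1; case: ifP => // _; rewrite powR_ge0.
have G20 d : 0 <= G2 d by rewrite /G2; case: ifP => // _; rewrite powR_ge0.
have term (u : l.-tuple ('I_n * 'I_m)) (v : (k - l).-tuple ('I_m * bool)) :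
   (diam_pow s (if heavy c e u v then box L u v else set0) <=
      (A * (\prod_(d <- u) G1 d * \prod_(b <- v) G2 b))%:E)%E.
  case: ifPn => [/and3P[uD vB]|_]; last first.
    rewrite /diam_pow eqxx lee_fin !mulr_ge0 ?powR_ge0 ?expR_ge0//; exact: prodr_ge0.
  rewrite size_tuple => heavyuv.
  apply: (@le_trans _ _ ((4 * L * m%:R^-1 ^+ k) `^ s)%:E).
    apply: diam_pow_le => //; first by rewrite !mulr_ge0.
    have kE : k = (size u + size v)%N by rewrite !size_tuple subnKC.
    by rewrite [in leRHS]kE; apply: diam_box => //; rewrite -kE size_tuple.
  rewrite lee_fin /A -[leRHS]mulrA ler_peMr ?powR_ge0//.
  (* The two products multiply to [exp (beta S_k - S_l)], which is what [heavy] bounds from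
     below. *)
  rewrite (prod_weight (r := fun d => rc (digit_row eta d)))// prod_weight//.
  rewrite -!expRD -[leLHS]expR0 ler_expR.
  move: heavyuv; rewrite big_cat/= big_map mulrBl mul1r mulrDr; lra.
apply: (le_trans (lee_sum _ (fun u _ => lee_sum _ (fun v _ => term u v)))).
under eq_bigr do rewrite sumEFin.
rewrite sumEFin lee_fin.
under eq_bigr do rewrite -mulr_sumr.
rewrite -mulr_sumr -big_distrlr/= !sum_prod_tuple.
rewrite sum_digit_weights -big_mkcond -/Z -exprD subnKC//.
have Z0 : 0 < Z by apply: lt_le_trans ltr01 _; exact: row_sum_ge1.
have m0 : 0 < m%:R :> R by rewrite ltr0n.
rewrite /A powRM ?mulr_ge0// -!mulrA ler_wpM2l ?powR_ge0//.
rewrite /powR gt_eqF ?exprn_gt0 ?invr_gt0// lnXn ?invr_gt0// lnV ?posrE//.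
rewrite -[in X in _ * (_ * X) <= _](lnK (_ : Z \in Num.pos)) ?posrE// -expRM_natl -!expRD ler_expR.
have := ler_wpM2r (ler0n R k) es.
have : e * l%:R <= e * k%:R by rewrite ler_wpM2l// ler_nat.
rewrite -mulr_natl; lra.
Qed.

Lemma ln_rc_bound b : 0 <= ln ((rc b)%:R : R) <= ln n%:R.
Proof.
have := max_card (row_digits D eta b); rewrite card_ord -/(row_count D eta b) -/(rc b).
(* By the convention [ln 0 = 0] the bounds also hold at empty row branches. *)
case: (rc b) => [_|k kn]; first by rewrite ln0 ?lexx//= ln_ge0// ler1n.
by rewrite ln_ge0 ?ler1n//= ler_ln ?posrE ?ltr0n// ler_nat.
Qed.

(** The largest [k] with [m ^ k <= n ^ l]: the height [m ^ -k] then exceeds the width [n ^ -l] by a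
    factor less than [m]. *)
Let kappa l := trunc_log m (n ^ l).

Lemma kappa_spec l : (l <= kappa l)%N /\
  beta * (kappa l)%:R <= l%:R <= beta * (kappa l)%:R + beta.
Proof.
have nl0 : (0 < n ^ l)%N by rewrite expn_gt0 n_gt0.
have lm0 : 0 < ln m%:R :> R := ln_m_gt0 m_ge2.
have ln0 : 0 < ln n%:R :> R := ln_n_gt0 m_ge2 m_lt_n.
have lnX (a b k j : nat) : (0 < a)%N -> (0 < b)%N -> (a ^ k <= b ^ j)%N ->
    k%:R * ln a%:R <= j%:R * ln b%:R :> R.
  move=> a0 b0 h; rewrite !mulr_natl -!lnXn ?ltr0n// -!natrX.
  rewrite ler_ln ?posrE ?ltr0n ?expn_gt0 ?a0 ?b0//.
  by rewrite ler_nat.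
split; first by apply: trunc_log_max => //; case: (l) => // k; rewrite leq_exp2r// ltnW.
have betaE : beta * ln n%:R = ln m%:R by rewrite /beta divfK ?gt_eqF.
apply/andP; split; rewrite -(ler_pM2r ln0).
  rewrite mulrAC betaE mulrC; apply: lnX => //; exact: trunc_logP.
rewrite mulrDl mulrAC betaE -[X in _ + X]mulr1 -mulrDr natr1 [leRHS]mulrC.
by apply: lnX => //; apply/ltnW; exact: trunc_log_ltn.
Qed.

Lemma kappa_ratio l : n%:R^-1 ^+ l <= m%:R^-1 ^+ kappa l :> R.
Proof.
rewrite !exprVn lef_pV2 ?posrE ?exprn_gt0 ?ltr0n// -!natrX ler_nat.
by apply: trunc_logP => //; rewrite expn_gt0 n_gt0.
Qed.

Lemma iter_kappa_le l0 j J : (j <= J)%N -> (iter j kappa l0 <= iter J kappa l0)%N.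
Proof.
elim: J => [|J IH]; first by rewrite leqn0 => /eqP ->.
rewrite leq_eqVlt => /predU1P[->//|/IH h]; apply: (leq_trans h).
by have [] := kappa_spec (iter J kappa l0).
Qed.

(** The cover consists of the heavy boxes at [J] consecutive levels of the chain from [l0]; each
    point of [K] lies in one of them by [chain_good_step]. Light boxes are replaced by [set0]. *)
Lemma premeasure_le (L e s delta : R) (J l0 : nat) :
  (forall p, K p -> `|p.1| <= L /\ `|p.2| <= L) -> 0 <= L -> 0 <= s -> 0 < e ->
  ln Z + 2 * e <= s * ln m%:R -> ln n%:R < J%:R * e -> (0 < l0)%N ->
  4 * L * m%:R^-1 ^+ l0 <= delta ->
  (hausdorff_premeasure s delta K <=
    (J%:R * ((4 * L) `^ s * expR (beta * ln n%:R) * expR (- e) ^+ l0))%:E)%E.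
Proof.
move=> KL L0 s0 e0 es MJ l00 delta_big.
pose c := beta * ln n%:R; pose kj j := iter j kappa l0.
have kjS j : (kj j <= kj j.+1)%N by have [] := kappa_spec (kj j).
have l0kj j : (l0 <= kj j)%N by exact: (@iter_kappa_le l0 0%N).
have m1 : 0 < m%:R^-1 :> R by rewrite invr_gt0 ltr0n.
pose index (j : 'I_J) : finType :=
  ((kj j).-tuple ('I_n * 'I_m) * (kj j.+1 - kj j).-tuple ('I_m * bool))%type.
pose I : finType := {j : 'I_J & index j}.
pose W (j : 'I_J) (uv : index j) :=
  if heavy c e uv.1 uv.2 then box L uv.1 uv.2 else set0.
pose V (i : I) := W (tag i) (tagged i).
apply: (@le_trans _ _ (\sum_i diam_pow s (V i))%E).
  apply: hausdorff_premeasure_le_finite => [p Kp|[j [u v]]]; last first.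
    rewrite /V /W /=; case: ifP => _; last by apply: diam_le.
    have kE : (size u + size v = kj j.+1)%N by rewrite !size_tuple subnKC.
    apply: (@le_trans _ _ (4 * L * m%:R^-1 ^+ (kj j.+1))%:E).
      by rewrite -kE; apply: diam_box => //; rewrite kE size_tuple; exact: kappa_ratio.
    rewrite lee_fin (le_trans _ delta_big)// ler_wpM2l ?mulr_ge0//.
    by rewrite ler_wiXn2l ?(ltW m1)// invf_le1 ?ltr0n// ler1n.
  have [w [q [sw wD Kq pE]]] := attractor_coding (kj J) Kp.
  (* Past the length of [w] the sums stay constant, so [SM] holds at every [k]. *)
  pose S k : R := \sum_(b <- rows (take k w)) ln (rc b)%:R.
  have SM k : 0 <= S k <= ln n%:R * k%:R.
    apply/andP; split; first by apply: sumr_ge0 => b _; have /andP[] := ln_rc_bound b.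
    apply: (@le_trans _ _ (\sum_(b <- rows (take k w)) ln n%:R)).
      by apply: ler_sum => b _; have /andP[] := ln_rc_bound b.
    rewrite big_const_seq count_predT iter_addr_0 -[leLHS]mulr_natr ler_wpM2l ?ler_nat//.
      by rewrite ln_ge0// ler1n.
    by rewrite size_map size_take_min geq_minl.
  have [j jJ jgood] := chain_good_step (beta_gt0 m_ge2 m_lt_n) e0 MJ l00 SM kappa_spec.
  pose l := kj j; pose k := kj j.+1.
  have lk : (l <= k)%N by exact: kjS.
  have kN : (k <= size w)%N by rewrite sw; exact: iter_kappa_le.
  have lN := leq_trans lk kN.
  pose u := take l w; pose v := rows (drop l (take k w)).
  have su : size u == l by rewrite size_take_min (minn_idPl lN).
  have sv : size v == (k - l)%N by rewrite size_map size_drop size_take_min (minn_idPl kN).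
  have uvE : rows u ++ v = rows (take k w).
    by rewrite /v /u -(take_takel w lk) -map_cat cat_take_drop.
  have tailK i : K (foldr (carpet_map sigma eta) q (drop i w)).
    have : all (fun d => d \in D) (drop i w) by apply/allP => d /mem_drop; apply/allP.
    move=> wiD; apply: (foldr_stable (U := K) (W := fun d => d \in D)) => // d x dD.
    exact: (attractor_carpet_map K_attractor dD).
  exists (Tagged index (i := Ordinal jJ) (Tuple su, Tuple sv)) => //.
  rewrite /V /W /=; have -> : heavy c e u v.
    apply/and3P; split.
    - by apply/allP => d /mem_take; apply/allP.
    - apply/allP => b /mapP[d /mem_drop/mem_take dw ->].
      by apply: digit_row_in_branches; exact: (allP wD).
    - by rewrite uvE (eqP su); exact: jgood.
  have prefix i : p =
      foldr (carpet_map sigma eta) (foldr (carpet_map sigma eta) q (drop i w)) (take i w).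
    by rewrite -foldr_cat cat_take_drop.
  split.
    rewrite {1}(prefix l) foldr_carpet_map /=.
    rewrite (affine_dist _ _ (affine_foldr _ (affine_column_branch sigma))) subr0 mulrC.
    by rewrite ler_wpM2r ?exprn_ge0//; have [] := KL _ (tailK l).
  rewrite {1}(prefix k) foldr_carpet_map /= uvE.
  rewrite (affine_dist _ _ (affine_foldr _ (@affine_row_branch R m))) subr0 mulrC.
  rewrite (eqP su) (eqP sv) subnKC// size_map size_take_min (minn_idPl kN).
  by rewrite ler_wpM2r ?exprn_ge0//; have [] := KL _ (tailK k).
have -> : (\sum_i diam_pow s (V i))%E = (\sum_(j < J) \sum_uv diam_pow s (W j uv))%E.
  by rewrite sig_big_dep.
apply: (@le_trans _ _
  (\sum_(j < J) ((4 * L) `^ s * expR (beta * ln n%:R) * expR (- e) ^+ l0)%:E)%E).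
  apply: lee_sum => j _.
  rewrite -(pair_bigA _ (fun u v => diam_pow s (W j (u, v)))) /W /=.
  apply: (le_trans (level_sum c L0 (ltW e0) s0 (kjS j) (kappa_ratio _) es)).
  rewrite lee_fin ler_wpM2l ?mulr_ge0 ?powR_ge0 ?expR_ge0//.
  rewrite -expRM_natl ler_expR mulrN lerN2 mulrC ler_wpM2l ?(ltW e0)// ler_nat.
  exact: l0kj.
by rewrite sumEFin lee_fin sumr_const card_ord -[leLHS]mulr_natl.
Qed.

Lemma carpet_upper_bound s : 0 <= s -> ln Z < s * ln m%:R -> hausdorff_measure s K = 0%E.
Proof.
move=> s0 Zs; have [[p0 Kp0] cK _] := K_attractor.
have [L KL] := compact_plane_bounded cK.
have L0 : 0 <= L by have [/(le_trans (normr_ge0 _))] := KL _ Kp0.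
pose e : R := (s * ln m%:R - ln Z) / 2.
have e0 : 0 < e by rewrite divr_gt0// subr_gt0.
have es : ln Z + 2 * e <= s * ln m%:R by rewrite /e; lra.
pose J := (Num.truncn (ln n%:R / e)).+1.
have MJ : ln n%:R < J%:R * e by rewrite -ltr_pdivrMr// truncnS_gt.
have small delta : 0 < delta -> (hausdorff_premeasure s delta K <= 0)%E.
  move=> delta0; apply/lee_addgt0Pr => E E0; rewrite add0e.
  pose C : R := J%:R * ((4 * L) `^ s * expR (beta * ln n%:R)).
  have C0 : 0 <= C by rewrite !mulr_ge0 ?powR_ge0 ?expR_ge0.
  have x01 : 0 < expR (- e) < 1 by rewrite expR_gt0 -expR0 ltr_expR oppr_lt0.
  have y01 : 0 < (m%:R^-1 : R) < 1 by rewrite invr_gt0 ltr0n m_gt0 invf_lt1 ?ltr0n// ltr1n.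
  (* [l1] controls the sum and [l2] the diameters; the 1 added to each denominator covers the case
     of a vanishing constant. *)
  have [l1 h1] := exists_expr_lt x01 (divr_gt0 E0 (ltr_wpDl C0 ltr01)).
  have [l2 h2] := exists_expr_lt y01 (divr_gt0 delta0 (ltr_wpDl (mulr_ge0 (ler0n R 4) L0) ltr01)).
  pose l0 := (l1 + l2).+1.
  have shrink (x : R) l : 0 < x < 1 -> (l <= l0)%N -> x ^+ l0 <= x ^+ l.
    by move=> /andP[x0 x1] ll; rewrite ler_wiXn2l ?ltW.
  have absorb (c y z : R) : 0 <= c -> 0 <= y -> y < z / (c + 1) -> c * y <= z.
    by move=> c0 y0; rewrite ltr_pdivlMr ?ltr_wpDl//; lra.
  apply: (le_trans (premeasure_le (l0 := l0) KL L0 s0 e0 es MJ _ _)) => //.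
    apply: absorb => //; first by rewrite mulr_ge0.
    by apply: le_lt_trans h2; apply: shrink => //; rewrite /l0 ltnW// ltnS leq_addl.
  rewrite lee_fin mulrA; apply: absorb => //.
  by apply: le_lt_trans h1; apply: shrink => //; rewrite /l0 ltnW// ltnS leq_addr.
apply/eqP; rewrite eq_le; apply/andP; split.
  by apply: ge_ereal_sup => _ [delta delta0 <-]; exact: small.
apply: le_trans (hausdorff_premeasure_ge0 s 1 K) _.
by apply: ereal_sup_ubound; exists 1 => //=; exact: ltr01.
Qed.

End Upper.

Theorem theorem1p2 (R : realType) (n m : nat) (D : {set 'I_n * 'I_m})
    (sigma eta : 'I_n * 'I_m -> bool) (K : set (R * R))
    (m_ge2 : (2 <= m)%N) (m_lt_n : (m < n)%N) (D_neq0 : D != finset.set0)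
    (K_attractor : is_attractor D (carpet_map sigma eta) K)
    (rows_osc : open_set_condition (row_branches D eta) (@row_branch R m)) :
  let beta : R := ln m%:R / ln n%:R in
  hausdorff_dim K =
    ((ln m%:R)^-1 *
     ln (\sum_(b in row_branches D eta) (row_count D eta b)%:R `^ beta))%:E.
Proof.
move=> beta; set d := (X in X%:E).
have lm0 : 0 < ln m%:R :> R := ln_m_gt0 m_ge2.
have d0 : 0 <= d.
  by rewrite mulr_ge0 ?invr_ge0 ?(ltW lm0)// ln_ge0//; exact: row_sum_ge1.
apply/eqP; rewrite eq_le; apply/andP; split; last first.
  apply: le_ereal_inf_tmp => _ [t [t0 Kt] <-]; rewrite lee_fin.
  exact: (carpet_lower_bound m_ge2 m_lt_n D_neq0 K_attractor rows_osc t0 Kt).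
(* The upper bound asks for a strict inequality, so it is applied just above [d]. *)
apply/lee_addgt0Pr => e e0; apply: ereal_inf_lbound; exists (d + e) => //.
have de0 : 0 <= d + e by rewrite addr_ge0// ltW.
split => //; apply: (carpet_upper_bound m_ge2 m_lt_n D_neq0 K_attractor de0).
by rewrite -ltr_pdivrMr// mulrC -/d ltrDl.
Qed.
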